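(* Let $n=3$ and let $X_1,X_2,X_3$ be a random sample from the exponential distribution with density $f(x)=e^{-x}$, $x>0$. Then the cumulative distribution function $F$ of $T=\bar X/S$ is given by $$F(t)=\begin{cases}1-\dfrac{2\pi}{3\sqrt3\,t^2}, & t\ge\sqrt2,\\[2ex] -\dfrac{\sqrt{2-t^2}}{\sqrt3\,t}+\dfrac{\pi}{3\sqrt3\,t^2}-\dfrac{2\arcsin\left(\frac{t}{\sqrt2}\right)}{\sqrt3\,t^2}+1, & \dfrac{\sqrt2}{2}\le t\le\sqrt2.\end{cases}$$
   Context: A random sample is a collection of independent identically distributed random variables. For a sample $X_1,\dots,X_n$, $\bar X=\frac1n\sum_{i=1}^n X_i$ is the sample mean, $S^2=\frac1n\sum_{i=1}^n (X_i-\bar X)^2$ is the biased sample variance, and $S=\sqrt{S^2}$. *)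

(* Defs.v *)
From HB Require Import structures.
From mathcomp Require Import all_boot all_order all_algebra.
From mathcomp Require Import all_classical all_reals all_analysis.
From mathcomp Require Import measurable_realfun.

Set Implicit Arguments.
Unset Strict Implicit.
Unset Printing Implicit Defensive.

Import Order.TTheory GRing.Theory Num.Theory.
Import numFieldNormedType.Exports.

Local Open Scope classical_set_scope.
Local Open Scope ring_scope.

(* The product rule is required over every subfamily J, so that this is mutual
   (not merely pairwise) independence. *)
Definition mutually_independent (R : realType) (d d' : measure_display)
    (Omega : measurableType d) (E : measurableType d')
    (P : probability Omega R) (I : finType) (X : I -> {RV P >-> E}) : Prop :=
  forall (J : {set I}) (A : I -> set E),
    (forall i, i \in J -> measurable (A i)) ->
    P (\bigcap_(i in [set` J]) (X i @^-1` A i)) =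
      (\prod_(i in J) P (X i @^-1` A i))%E.

(* [Q] is only evaluated on measurable sets: it need not carry a measure
   structure (as is the case of [exponential_prob]), and the values of a
   distribution outside the sigma-algebra are meaningless. *)
Definition random_sample (R : realType) (d d' : measure_display)
    (Omega : measurableType d) (E : measurableType d')
    (P : probability Omega R) (I : finType) (X : I -> {RV P >-> E})
    (Q : set E -> \bar R) : Prop :=
  mutually_independent X /\
  forall (i : I) (A : set E), measurable A -> distribution P (X i) A = Q A.

Section sample_statistics.
Context {R : realType} {d : measure_display} {Omega : measurableType d}.
Context {P : probability Omega R} {n : nat}.
Variable X : 'I_n -> {RV P >-> R}.

Definition sample_mean (w : Omega) : R := n%:R^-1 * \sum_(i < n) X i w.

(* The normalisation is 1/n (biased variance), not 1/(n-1). *)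
Definition sample_variance (w : Omega) : R :=
  n%:R^-1 * \sum_(i < n) (X i w - sample_mean w) ^+ 2.

Definition sample_sd (w : Omega) : R := Num.sqrt (sample_variance w).

(* Where [sample_sd] vanishes, the quotient is 0 by the convention x / 0 = 0. *)
Definition mean_sd_ratio (w : Omega) : R := sample_mean w / sample_sd w.

Let measurable_sample_mean : measurable_fun [set: Omega] sample_mean.
Proof.
apply: measurable_funM => //.
by apply: measurable_sum => i; exact: measurable_funPT.
Qed.

HB.instance Definition _ :=
  isMeasurableFun.Build _ _ _ _ sample_mean measurable_sample_mean.

Let measurable_sample_variance : measurable_fun [set: Omega] sample_variance.
Proof.
apply: measurable_funM => //.
apply: measurable_sum => i; apply: measurable_funX.
by apply: measurable_funB; [exact: measurable_funPT|exact: measurable_sample_mean].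
Qed.

HB.instance Definition _ :=
  isMeasurableFun.Build _ _ _ _ sample_variance measurable_sample_variance.

Let measurable_sample_sd : measurable_fun [set: Omega] sample_sd.
Proof.
apply: (measurableT_comp _ measurable_sample_variance).
by apply: continuous_measurable_fun; exact: sqrt_continuous.
Qed.

HB.instance Definition _ :=
  isMeasurableFun.Build _ _ _ _ sample_sd measurable_sample_sd.

Let measurable_mean_sd_ratio : measurable_fun [set: Omega] mean_sd_ratio.
Proof.
apply: measurable_funM; first exact: measurable_sample_mean.
rewrite (_ : (fun w => _) = (fun x => x `^ (- 1)) \o sample_sd).
  exact: (measurableT_comp (measurable_powR _) measurable_sample_sd).
by apply/funext => w /=; rewrite powR_inv1// sqrtr_ge0.
Qed.

HB.instance Definition _ :=
  isMeasurableFun.Build _ _ _ _ mean_sd_ratio measurable_mean_sd_ratio.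

End sample_statistics.

(* Main.v *)
(* Conditionally on the sum [s] of the sample, the point [X / s] is uniform on
   the triangle [x + y + z = 1] of the positive orthant, and [t < mean / sd]
   says that it lies in a disc centred at the barycentre.  The tail probability
   is therefore the ratio of two areas: for [sqrt 2 <= t] the disc is inside the
   triangle, and for [sqrt 2 / 2 <= t <= sqrt 2] it sticks out along three arcs.
   Integrating out [s] amounts to the shear [(x, y) |-> (x, x + y)] and the
   homogeneity of the cone; the area is computed along the lines [x = const]. *)
Require Import Defs.
From HB Require Import structures.
From mathcomp Require Import all_boot all_order all_algebra.
From mathcomp Require Import all_classical all_reals all_analysis.
From mathcomp Require Import measurable_realfun ring lra.

Import Order.TTheory GRing.Theory Num.Theory.
Import numFieldNormedType.Exports.

Local Open Scope classical_set_scope.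
Local Open Scope ring_scope.

(** * Lebesgue integrals and joint laws *)

(** On a line [x = u] the triangle and the disc cut out segments with the same midpoint [y = z], by
    symmetry. The intersection therefore has the smaller of the two lengths, and one function, a
    minimum, serves both ranges of [t]. Areas are measured in the coordinates [(x, y)], where the
    triangle has area 1/2. The constant 2, obtained as the integral of [s ^+ 2 * expR (- s)], is the
    reciprocal of that area and turns an area into a probability. The half-width of the disc along
    the first axis is [a = sqrt 2 / (3 * t)]. It is 1/3 when the disc touches the sides
    ([t = sqrt 2]) and 2/3 when its boundary passes through the vertices ([t = sqrt 2 / 2]); these
    are the thresholds of the statement. The event must be described exactly, with strict
    inequalities and the centre removed because of the convention for a zero deviation. Lengths do
    not see these details, so sections are only sandwiched between intervals of equal length. *)

Lemma lebesgue_measure_affine (R : realType) (b c : R) (A : set R) :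
  0 < c -> measurable A ->
  lebesgue_measure ((fun y : R => (y - b) / c) @^-1` A) =
  (c%:E * lebesgue_measure A)%E.
Proof.
move=> c0 mA; pose phi : measurableTypeR R -> measurableTypeR R :=
  fun y => (y - b) / c.
have mphi : measurable_fun [set: measurableTypeR R] phi.
  by apply: measurable_funM => //; apply: measurable_funB.
have ci0 : 0 <= c^-1 by rewrite invr_ge0 ltW.
have -> : lebesgue_measure A =
    ((c^-1)%:E * lebesgue_measure (phi @^-1` A))%E.
  have /(_ mphi _ A mA) := @lebesgue_measure_unique R
    (mscale (NngNum ci0) (pushforward (@lebesgue_measure R) phi)).
  rewrite /mscale /pushforward /=; apply => _ [[u v] /= uv <-].
  rewrite -[RHS]/((c^-1)%:E * lebesgue_measure (phi @^-1` `]u, v]))%E.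
  rewrite (_ : phi @^-1` _ = `](c * u + b), (c * v + b)]%classic); last first.
    apply/seteqP; split=> x /=;
      rewrite /phi !in_itv/= ltr_pdivlMr// ler_pdivrMr//;
      by move=> /andP[? ?]; apply/andP; split; lra.
  rewrite !lebesgue_measure_itv/= !lte_fin ltrD2r ltr_pM2l//.
  case: ifPn => _; last by rewrite mule0.
  by rewrite -!EFinB -EFinM; congr (_%:E); field; lra.
by rewrite muleA -EFinM divff ?mul1e// gt_eqF.
Qed.

Lemma ge0_integral_affine (R : realType) (b c : R) (k : R -> \bar R) :
  0 < c -> measurable_fun [set: R] k -> (forall x, 0 <= k x)%E ->
  (\int[lebesgue_measure]_y k ((y - b) / c)%R =
   c%:E * \int[lebesgue_measure]_y k y)%E.
Proof.
move=> c0 mk k0.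
pose phi : measurableTypeR R -> measurableTypeR R := fun y => (y - b) / c.
have mphi : measurable_fun [set: measurableTypeR R] phi.
  by apply: measurable_funM => //; apply: measurable_funB.
have := @ge0_integral_pushforward _ _ _ _ _ phi mphi (@lebesgue_measure R)
  setT k measurableT mk (fun y _ => k0 y).
rewrite preimage_setT => <-.
rewrite -(@ge0_integral_mscale _ _ _ (@lebesgue_measure R) _ _
  (NngNum (ltW c0)))//.
apply: eq_measure_integral => // A mA _.
exact: (lebesgue_measure_affine R b c A c0 mA).
Qed.

(** Tonelli brings [x] outside on the right; for fixed [x] the inner integral is then a translation,
    the affine substitution with slope 1. *)
Lemma ge0_integral_shear (R : realType) (h : R * R -> \bar R) :
  measurable_fun [set: R * R] h -> (forall p, 0 <= h p)%E ->
  (\int[lebesgue_measure]_x \int[lebesgue_measure]_y h (x, y) =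
   \int[lebesgue_measure]_s \int[lebesgue_measure]_x h (x, s - x)%R)%E.
Proof.
move=> mh h0.
have mshear : measurable_fun [set: R * R] (fun p : R * R => h (p.1, p.2 - p.1)).
  apply: (measurableT_comp mh); apply: measurable_fun_pair => //.
  exact: measurable_funB.
rewrite -(@fubini_tonelli _ _ _ _ _ (@lebesgue_measure R)
  (@lebesgue_measure R) (fun p => h (p.1, p.2 - p.1)))//.
apply: eq_integral => x _ /=.
under [RHS]eq_integral do rewrite -[(_ - x)%R]divr1.
rewrite (ge0_integral_affine R x 1 (fun y => h (x, y)))// ?mul1e//.
exact: measurableT_comp.
Qed.

Section density.
Import HBNNSimple.

(** The density is given only through the measures of sets, that is, for indicators. Linearity
    extends the formula to simple functions, and monotone convergence to [h]. *)
Lemma ge0_integral_density d (T : measurableType d) (R : realType)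
    (mu nu : {measure set T -> \bar R}) (f : T -> R) (h : T -> \bar R) :
  measurable_fun [set: T] f -> (forall x, 0 <= f x) ->
  measurable_fun [set: T] h -> (forall x, 0 <= h x)%E ->
  (forall A, measurable A -> nu A = \int[mu]_(x in A) (f x)%:E)%E ->
  (\int[nu]_x h x = \int[mu]_x ((f x)%:E * h x))%E.
Proof.
move=> mf f0 mh h0 nuE.
have mfE : measurable_fun [set: T] (EFin \o f) by exact/measurable_EFinP.
have fE0 x : (0 <= (f x)%:E)%E by rewrite lee_fin.
pose g := nnsfun_approx measurableT mh.
have gh x : ((g n x)%:E @[n --> \oo] --> h x)%E by exact: cvg_nnsfun_approx.
have gnd x : {homo (fun n => (g n x)%:E) : a b / (a <= b)%N >-> (a <= b)%E}.
  by move=> a b ab; rewrite lee_fin; exact/lefP/nd_nnsfun_approx.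
have mg n : measurable_fun [set: T] (fun x => (g n x)%:E).
  exact/measurable_EFinP.
have g0 n x : (0 <= (g n x)%:E)%E by rewrite lee_fin.
have step n : (\int[nu]_x (g n x)%:E = \int[mu]_x ((f x)%:E * (g n x)%:E))%E.
  under eq_integral do rewrite fimfunE -fsumEFin//.
  under [RHS]eq_integral => x _.
    rewrite [X in (_ * X%:E)%E]fimfunE -fsumEFin// ge0_mule_fsumr; last first.
      by move=> r; rewrite EFinM nnfun_muleindic_ge0.
    over.
  rewrite ge0_integral_fsum//; last 2 first.
  - by move=> r; apply/measurable_EFinP; exact: measurable_funM.
  - by move=> r x _; rewrite EFinM nnfun_muleindic_ge0.
  rewrite ge0_integral_fsum//; last 2 first.
  - move=> r; apply: emeasurable_funM => //.
    by apply/measurable_EFinP; exact: measurable_funM.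
  - by move=> r x _; rewrite mule_ge0// EFinM nnfun_muleindic_ge0.
  apply: eq_fsbigr => r; rewrite inE => -[x0 _ <-].
  under eq_integral do rewrite EFinM.
  under [RHS]eq_integral do rewrite EFinM muleCA.
  rewrite !ge0_integralZl ?lee_fin//; last 3 first.
  - apply: emeasurable_funM => //; exact/measurable_EFinP.
  - by move=> x _; rewrite mule_ge0// lee_fin.
  - exact/measurable_EFinP.
  congr (_ * _)%E; rewrite integral_indic// setIT nuE// integral_mkcond.
  by apply: eq_integral => x _; rewrite epatch_indic.
transitivity (\int[nu]_x limn (fun n => (g n x)%:E))%E.
  by apply: eq_integral => x _; apply/esym/cvg_lim => //; exact: gh.
transitivity (\int[mu]_x limn (fun n => (f x)%:E * (g n x)%:E))%E; last first.
  apply: eq_integral => x _; apply/cvg_lim => //.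
  by apply: cvgeZl => //; exact: gh.
rewrite !monotone_convergence//.
- by congr (limn _); apply/funext => n; exact: step.
- by move=> n; exact: emeasurable_funM.
- by move=> n x _; exact: mule_ge0.
- by move=> x _ a b ab; apply: lee_wpmul2l => //; exact: gnd.
Qed.

End density.

(** Uniqueness of product measures is applied twice: with [A0] frozen, to pass from rectangles in
    the last two variables to all measurable sets [B], and then to the pair formed by [X0] and
    [(X1, X2)]. *)
Lemma joint_law3 (R : realType) d d0 d1 d2 (Omega : measurableType d)
    (E0 : measurableType d0) (E1 : measurableType d1) (E2 : measurableType d2)
    (P : probability Omega R) (X0 : {RV P >-> E0}) (X1 : {RV P >-> E1})
    (X2 : {RV P >-> E2}) :
  (forall A0 A1 A2, measurable A0 -> measurable A1 -> measurable A2 ->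
    P (X0 @^-1` A0 `&` (X1 @^-1` A1 `&` X2 @^-1` A2)) =
    (distribution P X0 A0 * (distribution P X1 A1 * distribution P X2 A2))%E) ->
  forall C, measurable C ->
    P ((fun w => (X0 w, (X1 w, X2 w))) @^-1` C) =
    (distribution P X0 \x (distribution P X1 \x distribution P X2))%E C.
Proof.
move=> indX C mC.
have mX12 : measurable_fun [set: Omega] (fun w => (X1 w, X2 w)).
  exact: measurable_fun_pair.
have mX012 : measurable_fun [set: Omega] (fun w => (X0 w, (X1 w, X2 w))).
  exact: measurable_fun_pair.
have step A0 B : measurable A0 -> measurable B ->
    P (X0 @^-1` A0 `&` (fun w => (X1 w, X2 w)) @^-1` B) =
    (distribution P X0 A0 * (distribution P X1 \x distribution P X2)%E B)%E.
  move=> mA0 mB.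
  have mXA0 : measurable (X0 @^-1` A0).
    by rewrite -[_ @^-1` _]setTI; exact: measurable_funPT.
  have mXB : measurable ((fun w => (X1 w, X2 w)) @^-1` B).
    by rewrite -[_ @^-1` _]setTI; exact: mX12.
  have pfin : P (X0 @^-1` A0) \is a fin_num by exact: fin_num_measure.
  have [p0|p0] := eqVneq (P (X0 @^-1` A0)) 0%E.
    rewrite [distribution P X0 A0]p0 mul0e; apply/eqP.
    rewrite eq_le measure_ge0 andbT -[leRHS]p0 le_measure ?inE//.
      exact: measurableI.
  have ip0 : 0 <= (fine (P (X0 @^-1` A0)))^-1 by rewrite invr_ge0 fine_ge0.
  have H := @product_measure_unique _ _ _ _ _
    (distribution P X1) (distribution P X2)
    (mscale (NngNum ip0) (pushforward (mrestr P mXA0) (fun w => (X1 w, X2 w)))).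
  have {H} := H mX12; rewrite /mscale /pushforward /mrestr /=.
  move=> /(_ _ B mB) ->; last first.
    move=> A1 A2 mA1 mA2; rewrite -[LHS]/(((fine (P (X0 @^-1` A0)))^-1)%:E *
      P ((fun w => (X1 w, X2 w)) @^-1` (A1 `*` A2) `&` X0 @^-1` A0))%E setIC.
    rewrite (_ : _ @^-1` (A1 `*` A2) = X1 @^-1` A1 `&` X2 @^-1` A2)// indX//.
    rewrite muleA [distribution P X0 A0]/(P (X0 @^-1` A0)).
    rewrite -[X in (_ * X * _)%E](fineK pfin).
    by rewrite -EFinM mulVf ?mul1e// -eqe fineK.
  rewrite -[RHS]/(P (X0 @^-1` A0) * (((fine (P (X0 @^-1` A0)))^-1)%:E *
    P ((fun w => (X1 w, X2 w)) @^-1` B `&` X0 @^-1` A0)))%E.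
  rewrite muleA -[X in (X * _ * _)%E](fineK pfin).
  by rewrite -EFinM divff ?mul1e 1?setIC// -eqe fineK.
pose m12 : probability (E1 * E2)%type R :=
  (distribution P X1 \x distribution P X2)%E.
have H := @product_measure_unique _ _ _ _ _ (distribution P X0) m12
  (pushforward P (fun w => (X0 w, (X1 w, X2 w)))).
have {H} := H mX012; rewrite /pushforward => -> //.
Qed.

(* The variables take values in [measurableTypeR R], the copy of [R] on which
   [lebesgue_measure] is a measure, so that laws and densities share a type. *)
Lemma joint_density3 (R : realType) d (Omega : measurableType d)
    (P : probability Omega R) (X0 X1 X2 : {RV P >-> measurableTypeR R})
    (f : R -> R) :
  measurable_fun [set: R] f -> (forall x, 0 <= f x) ->
  (forall A0 A1 A2 : set R, measurable A0 -> measurable A1 -> measurable A2 ->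
    P (X0 @^-1` A0 `&` (X1 @^-1` A1 `&` X2 @^-1` A2)) =
    (P (X0 @^-1` A0) * (P (X1 @^-1` A1) * P (X2 @^-1` A2)))%E) ->
  (forall A : set R, measurable A ->
    P (X0 @^-1` A) = \int[lebesgue_measure]_(x in A) (f x)%:E)%E ->
  (forall A : set R, measurable A ->
    P (X1 @^-1` A) = \int[lebesgue_measure]_(x in A) (f x)%:E)%E ->
  (forall A : set R, measurable A ->
    P (X2 @^-1` A) = \int[lebesgue_measure]_(x in A) (f x)%:E)%E ->
  forall C : set (R * (R * R)), measurable C ->
    (P ((fun w => (X0 w, (X1 w, X2 w))) @^-1` C) =
    \int[lebesgue_measure]_x \int[lebesgue_measure]_y \int[lebesgue_measure]_z
      (f x * f y * f z * \1_C (x, (y, z)))%:E)%E.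
Proof.
move=> mf f0 indX law0 law1 law2 C mC.
have mC' : @measurable _
    (measurableTypeR R * (measurableTypeR R * measurableTypeR R))%type C.
  exact: mC.
have dens := ge0_integral_density _ (measurableTypeR R) R lebesgue_measure.
pose m12 : probability (measurableTypeR R * measurableTypeR R)%type R :=
  (distribution P X1 \x distribution P X2)%E.
have m12C : measurable_fun [set: measurableTypeR R] (m12 \o xsection C).
  exact: measurable_fun_xsection.
have m2C x : measurable_fun [set: measurableTypeR R]
    (distribution P X2 \o xsection (xsection C x)).
  by apply: measurable_fun_xsection; exact: measurable_xsection.
rewrite joint_law3//.
(* A product measure unfolds to the integral of the measures of the sections, so each law can be
   traded for its density, from the outermost variable inwards. *)
rewrite -[LHS]/(\int[distribution P X0]_x (m12 \o xsection C) x)%E.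
rewrite (dens (distribution P X0) f)//.
apply: eq_integral => x _.
rewrite -[(m12 \o _) x]/(\int[distribution P X1]_y
  (distribution P X2 \o xsection (xsection C x)) y)%E.
rewrite (dens (distribution P X1) f)//.
rewrite -ge0_integralZl ?lee_fin//; last 2 first.
- by apply: emeasurable_funM => //; exact/measurable_EFinP.
- by move=> y _; rewrite mule_ge0// lee_fin.
apply: eq_integral => y _ /=.
rewrite [distribution P X2 _]law2; last first.
  exact/measurable_xsection/measurable_xsection.
rewrite integral_mkcond muleA -EFinM -ge0_integralZl ?lee_fin ?mulr_ge0//.
- apply: eq_integral => z _.
  rewrite patchE indicE mem_xsection mem_xsection.
  by case: ifPn => _; rewrite ?mulr1 ?mulr0 ?EFinM ?mule0.
- apply/(measurable_restrictT (EFin \o f)).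
    exact/measurable_xsection/measurable_xsection.
  by apply: measurable_funTS; exact/measurable_EFinP.
- by move=> z _; rewrite patchE; case: ifPn => // _; rewrite lee_fin.
Qed.

(** * Areas in the triangle *)

Lemma derive1_sin_affine (R : realType) (c a : R) :
  (fun x => c + a * sin x)^`()%classic = (fun x => a * cos x).
Proof.
apply/funext => x; rewrite derive1E derive_val.
by rewrite /GRing.scale/=; ring.
Qed.

Lemma derivable_continuous (R : realType) (F : R -> R) :
  (forall x, derivable F x 1) -> continuous F.
Proof. by move=> dF x; exact/differentiable_continuous/derivable1_diffP/dF. Qed.

Lemma derivable_oo_LRcontinuous_ex (R : realType) (F : R -> R) (a b : R) :
  (forall x, derivable F x 1) -> derivable_oo_LRcontinuous F a b.
Proof.
move=> dF; have cF := derivable_continuous _ _ dF.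
split => //.
- exact/cvg_at_right_filter/cF.
- exact/cvg_at_left_filter/cF.
Qed.

(* The substitution [x = c + a sin th] turns the square root into [a cos th]. *)
Lemma integral_circle_chord (R : realType) (a c al be : R) :
  0 < a -> - (pi / 2) <= al -> al <= be -> be <= pi / 2 ->
  (\int[lebesgue_measure]_(x in `[(c + a * sin al)%R, (c + a * sin be)%R])
     (Num.sqrt (a ^+ 2 - (x - c) ^+ 2))%:E =
   (a ^+ 2 / 2 * ((be + sin be * cos be) - (al + sin al * cos al)))%:E)%E.
Proof.
move=> a0 alN; rewrite le_eqVlt => /predU1P[<- _|albe bepi].
  by rewrite set_itv1 integral_set1; congr (_%:E); ring.
have in_pihalf x : x \in `[al, be] -> x \in `[(- (pi / 2)), (pi / 2)].
  by rewrite !in_itv/= => /andP[? ?]; apply/andP; split; lra.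
have dF x : derivable (fun x => c + a * sin x) x 1 by exact: ex_derive.
have cG : continuous (fun x => Num.sqrt (a ^+ 2 - (x - c) ^+ 2)).
  move=> x; apply: (@continuous_comp _ _ _ (fun x => a ^+ 2 - (x - c) ^+ 2));
    last exact: sqrt_continuous.
  by apply: derivable_continuous => y; exact: ex_derive.
have cacos : continuous (fun x : R => a * cos x).
  by apply: derivable_continuous => x; exact: ex_derive.
rewrite (@integration_by_substitution_increasing _ (fun x => c + a * sin x)
  (fun x => Num.sqrt (a ^+ 2 - (x - c) ^+ 2)) al be (ltW albe)); last 6 first.
- move=> x y xab yab xy.
  by rewrite ltrD2l ltr_pM2l// ltr_sin// in_pihalf.
- by rewrite derive1_sin_affine => x _; exact: cacos.
- by rewrite derive1_sin_affine; apply/cvg_ex; exists (a * cos al);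
    exact/cvg_at_right_filter/cacos.
- by rewrite derive1_sin_affine; apply/cvg_ex; exists (a * cos be);
    exact/cvg_at_left_filter/cacos.
- exact: derivable_oo_LRcontinuous_ex.
- by apply: continuous_subspaceT; exact: cG.
rewrite derive1_sin_affine.
transitivity
    (\int[lebesgue_measure]_(x in `[al, be]) (a ^+ 2 * cos x ^+ 2)%:E)%E.
  apply: eq_integral => x; rewrite inE/= => xab; congr (_%:E).
  rewrite !fctE addrAC subrr add0r exprMn.
  rewrite (_ : a ^+ 2 - a ^+ 2 * sin x ^+ 2 = (a * cos x) ^+ 2); last first.
    by rewrite exprMn cos2sin2; ring.
  rewrite sqrtr_sqr ger0_norm; first by ring.
  rewrite mulr_ge0 ?(ltW a0)// cos_ge0_pihalf//.
  by have := in_pihalf x xab; rewrite in_itv.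
rewrite (@continuous_FTC2 _ _ (fun x => a ^+ 2 / 2 * (x + sin x * cos x)))//.
- by rewrite -EFinB; congr (_%:E); ring.
- apply: continuous_subspaceT.
  by apply: derivable_continuous => x; exact: ex_derive.
- by apply: derivable_oo_LRcontinuous_ex => x; exact: ex_derive.
- move=> x _; rewrite derive1E derive_val /GRing.scale/=.
  have := cos2Dsin2 x => H.
  have -> : sin x * - sin x = cos x ^+ 2 - 1 by rewrite -H; ring.
  by field.
Qed.

Lemma ge0_integral_itv_split (R : realType) (f : R -> \bar R) (a m b : R) :
  measurable_fun [set: R] f -> (forall x, x \in `[a, b] -> 0 <= f x)%E ->
  a <= m -> m <= b ->
  (\int[lebesgue_measure]_(x in `[a, b]) f x =
   \int[lebesgue_measure]_(x in `[a, m]) f x +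
   \int[lebesgue_measure]_(x in `[m, b]) f x)%E.
Proof.
move=> mf f0 am mb.
have -> : `[a, b]%classic = `[a, m]%classic `|` `]m, b]%classic.
  by apply: itv_bndbnd_setU; rewrite bnd_simp.
rewrite ge0_integral_setU//=.
- by rewrite [X in (_ + X)%E]integral_itv_obnd_cbnd//; exact: measurable_funTS.
- exact: measurable_funTS.
- move=> x [] /=; rewrite in_itv/= => /andP[? ?]; apply: f0; rewrite ?in_itv/=;
    apply/andP; split; lra.
- rewrite disj_set2E; apply/eqP; rewrite -subset0 => x [] /=.
  rewrite !in_itv/= => /andP[_ xm] /andP[mx _].
  by move: (le_lt_trans xm mx); rewrite ltxx.
Qed.

Lemma ler_sin (R : realType) :
  {in `[(- (pi / 2)), pi / 2] &, {homo @sin R : x y / x <= y}}.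
Proof.
move=> x y xpi ypi; rewrite le_eqVlt => /predU1P[->//|xy].
by rewrite ltW// ltr_sin.
Qed.

(** The angles [pi / 3] and [pi / 6] are complementary, so the double angle formula gives
    [2 s^2 + s - 1 = (2 s - 1) (s + 1) = 0] for the sine [s], and [s] is positive. *)
Lemma sin_pi6 (R : realType) : sin (pi / 6 : R) = 2^-1.
Proof.
have pi0 := pi_gt0 R.
have s0 : 0 < sin (pi / 6 : R) by apply: sin_gt0_pi; lra.
have cs : cos (pi / 6 + pi / 6 : R) = sin (pi / 6).
  by rewrite -cosBpihalf -cosN; congr cos; field.
have := cos2Dsin2 (pi / 6 : R); rewrite cosD in cs => H.
have : (2 * sin (pi / 6 : R) - 1) * (sin (pi / 6 : R) + 1) = 0 by nra.
by move/eqP; rewrite mulf_eq0 => /orP[] /eqP; lra.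
Qed.

Lemma cos_pi6 (R : realType) : cos (pi / 6 : R) = Num.sqrt 3 / 2.
Proof.
have pi0 := pi_gt0 R.
have c0 : 0 <= cos (pi / 6 : R) by apply: cos_ge0_pihalf; lra.
rewrite -[LHS]ger0_norm// -sqrtr_sqr cos2sin2 sin_pi6.
rewrite (_ : 1 - 2^-1 ^+ 2 = 3 * 2^-1 ^+ 2 :> R); last by field.
by rewrite sqrtrM// sqrtr_sqr ger0_norm.
Qed.

Lemma cos_pi3 (R : realType) : cos (pi / 3 : R) = 2^-1.
Proof. by rewrite -sin_pi6 -cosBpihalf -cosN; congr cos; field. Qed.

Lemma sin_pi3 (R : realType) : sin (pi / 3 : R) = Num.sqrt 3 / 2.
Proof. by rewrite -cos_pi6 -cosBpihalf -cosN; congr cos; field. Qed.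

Lemma measurable_sqrtr (R : realType) : measurable_fun [set: R] (@Num.sqrt R).
Proof. by apply: continuous_measurable_fun; exact: sqrt_continuous. Qed.

(* Length, measured in the second coordinate, of the line [x = u] inside the
   triangle [x + y + z = 1] and the disc centred at its barycentre that projects
   onto [1/3 - a, 1/3 + a] on the first axis. *)
Definition chord (R : realType) (a u : R) : R :=
  Num.min (1 - u) (Num.sqrt 3 * Num.sqrt (a ^+ 2 - (u - 3^-1) ^+ 2)).

Section chord.
Context {R : realType}.
Implicit Types a u b : R.

Lemma measurable_chord a : measurable_fun [set: R] (chord R a).
Proof.
apply: measurable_minr; first exact: measurable_funB.
apply: measurable_funM => //.
apply: (measurableT_comp (measurable_sqrtr R)).
apply: measurable_funB => //; apply: measurable_funX; exact: measurable_funB.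
Qed.

Lemma chord_ge0 a u : u <= 1 -> 0 <= chord R a u.
Proof.
by move=> u1; rewrite /chord le_min subr_ge0 u1/= mulr_ge0// sqrtr_ge0.
Qed.

Let sqrt3_sqr : Num.sqrt 3 ^+ 2 = 3 :> R.
Proof. by rewrite sqr_sqrtr. Qed.

(** The second hypothesis compares the squares of the two arguments of the minimum. Geometrically,
    the ends of the segment cut out by the triangle are not interior to the disc. *)
Lemma chordE_sqrt a u : u <= 1 ->
  3 * a ^+ 2 <= (1 - u) ^+ 2 + 3 * (u - 3^-1) ^+ 2 ->
  chord R a u = Num.sqrt 3 * Num.sqrt (a ^+ 2 - (u - 3^-1) ^+ 2).
Proof.
move=> u1 au; rewrite /chord; apply/min_idPr.
have u0 : 0 <= 1 - u by lra.
rewrite -sqrtrM// -[leRHS]ger0_norm// -sqrtr_sqr ler_wsqrtr//; lra.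
Qed.

Lemma chordE_sub a u : u <= 1 ->
  (1 - u) ^+ 2 + 3 * (u - 3^-1) ^+ 2 <= 3 * a ^+ 2 -> chord R a u = 1 - u.
Proof.
move=> u1 au; rewrite /chord; apply/min_idPl.
have u0 : 0 <= 1 - u by lra.
rewrite -sqrtrM// -[leLHS]ger0_norm// -sqrtr_sqr ler_wsqrtr//; lra.
Qed.

(** [Num.sqrt] is 0 on negative arguments, so lines that miss the disc get length 0 from the same
    formula. *)
Lemma chord_out a u : u <= 1 -> a ^+ 2 <= (u - 3^-1) ^+ 2 -> chord R a u = 0.
Proof.
move=> u1 au; rewrite /chord (@ler0_sqrtr _ (_ - _)) ?mulr0; last by lra.
by apply/min_idPr; lra.
Qed.

Let integral_chord_sqrt a al be : 0 < a ->
  - (pi / 2) <= al -> al <= be -> be <= pi / 2 ->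
  (forall u, u \in `[3^-1 + a * sin al, 3^-1 + a * sin be] -> u <= 1 /\
    3 * a ^+ 2 <= (1 - u) ^+ 2 + 3 * (u - 3^-1) ^+ 2) ->
  (\int[lebesgue_measure]_(u in `[(3^-1 + a * sin al)%R, (3^-1 + a * sin be)%R])
    (chord R a u)%:E =
  (Num.sqrt 3 * (a ^+ 2 / 2 *
    ((be + sin be * cos be) - (al + sin al * cos al))))%:E)%E.
Proof.
move=> a0 alN albe bepi H.
rewrite EFinM -(integral_circle_chord _ _ 3^-1)// -ge0_integralZl ?lee_fin//.
- apply: eq_integral => u; rewrite inE/= => uab.
  by have [? ?] := H u uab; rewrite chordE_sqrt// EFinM.
- apply/measurable_EFinP; apply: measurable_funTS.
  apply: (measurableT_comp (measurable_sqrtr R)).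
  apply: measurable_funB => //; apply: measurable_funX; exact: measurable_funB.
Qed.

Let integral_chord_out a p q :
  (forall u, u \in `[p, q] -> u <= 1 /\ a ^+ 2 <= (u - 3^-1) ^+ 2) ->
  (\int[lebesgue_measure]_(u in `[p, q]) (chord R a u)%:E = 0)%E.
Proof.
move=> H; apply: integral0_eq => u /= /H[? ?]; by rewrite chord_out.
Qed.

Let integral_chord_sub a p q : p <= q ->
  (forall u, u \in `[p, q] -> u <= 1 /\
    (1 - u) ^+ 2 + 3 * (u - 3^-1) ^+ 2 <= 3 * a ^+ 2) ->
  (\int[lebesgue_measure]_(u in `[p, q]) (chord R a u)%:E =
    ((q - p) * (1 - (p + q) / 2))%:E)%E.
Proof.
rewrite le_eqVlt => /predU1P[<- _|pq H].
  by rewrite set_itv1 integral_set1 subrr mul0r.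
transitivity (\int[lebesgue_measure]_(u in `[p, q]) (1 - u)%:E)%E.
  apply: eq_integral => u; rewrite inE/= => /H[? ?].
  by rewrite chordE_sub.
rewrite (@continuous_FTC2 _ _ (fun u => u - u ^+ 2 / 2))//.
- by rewrite -EFinB; congr (_%:E); field.
- apply: continuous_subspaceT.
  by apply: derivable_continuous => x; exact: ex_derive.
- by apply: derivable_oo_LRcontinuous_ex => x; exact: ex_derive.
- move=> x _; rewrite derive1E derive_val /GRing.scale/=.
  by field.
Qed.

Let mchord a : measurable_fun [set: R] (fun u => (chord R a u)%:E).
Proof. by apply/measurable_EFinP; exact: measurable_chord. Qed.

Lemma integral_chord_inscribed a : 0 < a <= 3^-1 ->
  (\int[lebesgue_measure]_(u in `[0%R, 1%R]) (chord R a u)%:E =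
    (Num.sqrt 3 * (a ^+ 2 / 2 * pi))%:E)%E.
Proof.
move=> /andP[a0 a3].
have pi0 := pi_gt0 R.
have ge0 p q u : q <= 1 -> u \in `[p, q] -> (0 <= (chord R a u)%:E)%E.
  by rewrite in_itv/= lee_fin => q1 /andP[_ uq]; rewrite chord_ge0//; lra.
rewrite (ge0_integral_itv_split _ _ _ (3^-1 - a))//;
  [|by move=> u; apply: ge0; lra|lra|lra].
rewrite (ge0_integral_itv_split _ _ (3^-1 - a) (3^-1 + a))//;
  [|by move=> u; apply: ge0; lra|lra|lra].
rewrite [X in (X + _)%E]integral_chord_out; last first.
  by move=> u; rewrite in_itv/= => /andP[? ?]; split; nra.
rewrite [X in (_ + (_ + X))%E]integral_chord_out; last first.
  by move=> u; rewrite in_itv/= => /andP[? ?]; split; nra.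
rewrite add0e adde0.
have := @integral_chord_sqrt a (- (pi / 2)) (pi / 2) a0.
rewrite sinN sin_pihalf cosN cos_pihalf mulrN1 mulr1 => ->; [|lra|lra|lra|].
- by congr (_%:E); field.
- move=> u; rewrite in_itv/= => /andP[_ ua]; split; first lra.
  (* The right-hand side of the goal equals [4 * (u - 1/2)^2 + 1/3], and [3 * a^2 <= 1/3]. *)
  have := sqr_ge0 (u - 2^-1); have : a ^+ 2 <= 3^-1 ^+ 2 by nra.
  by lra.
Qed.

(* The radius is parametrised by [a = 1 / (3 sin b)], so that the circle crosses
   the sides of the triangle at the abscissas [0], [1/3 + a sin (b - pi/3)] and
   [1/3 + a sin (2 pi/3 - b)]. *)
Lemma integral_chord_truncated b : pi / 6 <= b <= pi / 2 ->
  (\int[lebesgue_measure]_(u in `[0%R, 1%R]) (chord R (3 * sin b)^-1 u)%:E =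
    (Num.sqrt 3 / (18 * sin b ^+ 2) * (3 * b - pi / 2) +
     cos b / (2 * Num.sqrt 3 * sin b))%:E)%E.
Proof.
move=> /andP[b6 b2]; have pi0 := pi_gt0 R.
set s := sin b; set k := cos b; set h := Num.sqrt 3; set a := (3 * s)^-1.
have h2 : h ^+ 2 = 3 by exact: sqrt3_sqr.
have h0 : 0 < h by rewrite sqrtr_gt0.
have s12 : 2^-1 <= s.
  by rewrite -sin_pi6; apply: ler_sin; rewrite ?in_itv/=; lra.
have s1 : s <= 1 by exact: sin_le1.
have k0 : 0 <= k by apply: cos_ge0_pihalf; lra.
have sk : k ^+ 2 + s ^+ 2 = 1 by exact: cos2Dsin2.
have as3 : a * s = 3^-1 by rewrite /a; field; lra.
have a0 : 0 < a by rewrite invr_gt0; lra.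
have a23 : a <= 2 / 3 by nra.
pose x1 := 3^-1 + a * sin (b - pi / 3).
pose x2 := 3^-1 + a * sin (2 * pi / 3 - b).
have S1 : sin (b - pi / 3) = s / 2 - h * k / 2.
  by rewrite sinB sin_pi3 cos_pi3 -/s -/k -/h; field.
have C1 : cos (b - pi / 3) = k / 2 + h * s / 2.
  by rewrite cosB sin_pi3 cos_pi3 -/s -/k -/h; field.
have E2 : 2 * pi / 3 - b = pi / 6 - b + pi / 2 :> R by field.
have S2 : sin (2 * pi / 3 - b) = s / 2 + h * k / 2.
  by rewrite E2 sinDpihalf cosB sin_pi6 cos_pi6 -/s -/k -/h; field.
have C2 : cos (2 * pi / 3 - b) = h * s / 2 - k / 2.
  by rewrite E2 cosDpihalf sinB sin_pi6 cos_pi6 -/s -/k -/h; field.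
have X1 : x1 = 2^-1 - a * h * k / 2 by rewrite /x1 S1; nra.
have X2 : x2 = 2^-1 + a * h * k / 2 by rewrite /x2 S2; nra.
(* The arc beyond the side [x = 0] is discarded: the angle starts at [- b] instead of
   [- (pi / 2)]. *)
have E0 : 0 = 3^-1 + a * sin (- b) by rewrite sinN mulrN -/s as3 subrr.
have E1 : 3^-1 + a = 3^-1 + a * sin (pi / 2) by rewrite sin_pihalf mulr1.
have ahk0 : 0 <= a * h * k by rewrite !mulr_ge0// ltW.
(* The difference of the squared arguments of the minimum factors over the crossing abscissas. Its
   sign thus selects the triangle between [x1] and [x2] and the disc elsewhere. *)
have cross u : (1 - u) ^+ 2 + 3 * (u - 3^-1) ^+ 2 - 3 * a ^+ 2 =
    4 * ((u - x1) * (u - x2)).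
  rewrite X1 X2.
  have -> : 3 * a ^+ 2 = (a * h * k) ^+ 2 + 3^-1.
    have -> : (a * h * k) ^+ 2 = a ^+ 2 * 3 * (1 - s ^+ 2).
      by rewrite !exprMn h2 -sk addrK.
    rewrite mulrBr mulr1.
    have -> : a ^+ 2 * 3 * s ^+ 2 = 3 * (a * s) ^+ 2 by ring.
    by rewrite as3; field.
  by field.
have x10 : 0 <= x1.
  by rewrite E0 lerD2l ler_pM2l//; apply: ler_sin; rewrite ?in_itv/=; lra.
have x12 : x1 <= x2 by lra.
have x2a : x2 <= 3^-1 + a by rewrite lerD2l -[leRHS]mulr1 ler_pM2l// sin_le1.
have ge0 p q u : q <= 1 -> u \in `[p, q] -> (0 <= (chord R a u)%:E)%E.
  by rewrite in_itv/= lee_fin => q1 /andP[_ uq]; rewrite chord_ge0//; lra.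
(* Four pieces: the disc bounds the chord on [[0, x1]], the triangle on [[x1, x2]], the disc again
   on [[x2, 1/3 + a]], and the chord is zero beyond. *)
rewrite (ge0_integral_itv_split _ _ _ x1)//;
  [|by move=> u; apply: ge0; lra|lra].
rewrite (ge0_integral_itv_split _ _ x1 x2)//;
  [|by move=> u; apply: ge0; lra|lra].
rewrite (ge0_integral_itv_split _ _ x2 (3^-1 + a))//;
  [|by move=> u; apply: ge0; lra|lra].
rewrite [X in (_ + (_ + (_ + X)))%E]integral_chord_out ?adde0; last first.
  by move=> u; rewrite in_itv/= => /andP[? ?]; split; nra.
rewrite [X in (_ + (X + _))%E]integral_chord_sub//; last first.
  move=> u; rewrite in_itv/= => /andP[? ?]; split; first lra.
  rewrite -subr_le0 cross; nra.
rewrite [X in (X + _)%E](_ : _ = (h * (a ^+ 2 / 2 *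
    (b - pi / 3 + sin (b - pi / 3) * cos (b - pi / 3) -
    (- b + sin (- b) * cos (- b)))))%:E); last first.
  rewrite [X in `[X, _]]E0 integral_chord_sqrt//; [lra|lra|lra|].
  rewrite -E0 -/x1 => u; rewrite in_itv/= => /andP[? ?]; split; first lra.
  by rewrite -subr_ge0 cross mulr_ge0// mulr_le0//; lra.
rewrite [X in (_ + (_ + X))%E](_ : _ = (h * (a ^+ 2 / 2 *
    (pi / 2 + sin (pi / 2) * cos (pi / 2) -
    (2 * pi / 3 - b + sin (2 * pi / 3 - b) * cos (2 * pi / 3 - b)))))%:E);
  last first.
  rewrite E1 integral_chord_sqrt//; [lra|lra|].
  rewrite -E1 -/x2 => u; rewrite in_itv/= => /andP[? ?]; split; first lra.
  by rewrite -subr_ge0 cross mulr_ge0// mulr_ge0//; lra.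
rewrite -!EFinD; congr (_%:E).
rewrite S1 C1 S2 C2 cos_pihalf mulr0 sinN cosN -/s -/k X1 X2.
rewrite (_ : k / (2 * h * s) = a * h * k / 2); last first.
  by rewrite /a -h2; field; lra.
rewrite (_ : h / (18 * s ^+ 2) = h * (a ^+ 2 / 2)); last first.
  by rewrite /a; field; lra.
(* Since [field] treats [h] as a free variable, the discrepancy is displayed as a multiple of
   [3 - h ^+ 2], which then vanishes. *)
transitivity (h * (a ^+ 2 / 2) * (3 * b - pi / 2) + a * h * k / 2 +
  h * (a ^+ 2 / 2) * (s * k * ((3 - h ^+ 2) / 2))); first by field.
by rewrite h2 subrr mul0r !mulr0 addr0.
Qed.

End chord.

(** * The cone where the ratio exceeds t *)

(** This is the value [2!] of the Gamma function at 3, computed from the primitive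
    [- (s^2 + 2 s + 2) exp (- s)]. *)
Lemma integral_sqr_expRN (R : realType) :
  (\int[lebesgue_measure]_(s in `[0%R, +oo[) (s ^+ 2 * expR (- s))%:E =
    2%:E :> \bar R)%E.
Proof.
have dF x : derivable (fun s : R => - ((s ^+ 2 + 2 * s + 2) * expR (- s))) x 1.
  exact: ex_derive.
have cF := derivable_continuous _ _ dF.
rewrite (@ge0_continuous_FTC2y _ _
  (fun s => - ((s ^+ 2 + 2 * s + 2) * expR (- s))) _ 0)//.
- by rewrite oppr0 expR0 -EFinB; congr (_%:E); ring.
- by move=> s _; rewrite mulr_ge0 ?sqr_ge0 ?expR_ge0.
- apply: continuous_subspaceT.
  by apply: derivable_continuous => x; exact: ex_derive.
- rewrite -oppr0; apply: cvgN.
  (* The factor 16 suffices: [exp (s / 2) >= 1 + s^2 / 8], and [16 + 2 s^2 >= s^2 + 2 s + 2]. *)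
  apply: (@squeeze_cvgr _ _ _ _ (fun=> 0) (fun s => 16 * expR (- (2^-1 * s)))).
  + near=> s; have s0 : 0 <= s by near: s; exact: nbhs_pinfty_ge.
    rewrite mulr_ge0 ?expR_ge0//=; last by have := sqr_ge0 (s + 1); lra.
    rewrite (_ : - (2^-1 * s) = 2^-1 * s + - s); last by field.
    rewrite expRD mulrA ler_wpM2r ?expR_ge0//.
    have := @expR_ge1Dxn _ (2^-1 * s) 1 (mulr_ge0 _ s0).
    rewrite (_ : 2`!%:R = 2 :> R)// => /(_ ltac:(lra)).
    have := sqr_ge0 (s - 1); rewrite exprMn; lra.
  + exact: cvg_cst.
  + rewrite -(mulr0 16); apply: cvgMl_tmp.
    apply: (@cvg_comp _ _ _ (fun s => 2^-1 * s) (fun s => expR (- s)) _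
      (pinfty_nbhs R)); last exact: cvgr_expR.
    by apply: gt0_cvgMry => //; lra.
- exact/cvg_at_right_filter/cF.
- move=> x _; rewrite derive1E derive_val /GRing.scale/=.
  by ring.
Unshelve. all: end_near. Qed.

(* [v] is three times the biased variance; [t < mean / sd] has been squared, and
   [0 < v] accounts for the convention [mean / 0 = 0]. *)
Definition ratio_cone (R : realType) (t : R) : set (R * (R * R)) :=
  [set p | let s := p.1 + (p.2.1 + p.2.2) in
           let v := (p.1 - s / 3) ^+ 2 + (p.2.1 - s / 3) ^+ 2 +
                    (p.2.2 - s / 3) ^+ 2 in
           [&& 0 < s, 0 < v & 3 * t ^+ 2 * v < s ^+ 2]].

Lemma measurable_ratio_cone (R : realType) (t : R) :
  measurable (ratio_cone R t).
Proof.
pose s (p : R * (R * R)) := p.1 + (p.2.1 + p.2.2).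
pose v p := (p.1 - s p / 3) ^+ 2 + (p.2.1 - s p / 3) ^+ 2 +
            (p.2.2 - s p / 3) ^+ 2.
have m2 : measurable_fun [set: R * (R * R)] (fun p => p.2.1).
  exact: (measurableT_comp measurable_fst measurable_snd).
have m3 : measurable_fun [set: R * (R * R)] (fun p => p.2.2).
  exact: (measurableT_comp measurable_snd measurable_snd).
have ms : measurable_fun [set: R * (R * R)] s.
  by apply: measurable_funD => //; apply: measurable_funD.
have ms3 : measurable_fun [set: R * (R * R)] (fun p => s p / 3).
  exact: measurable_funM.
have mv : measurable_fun [set: R * (R * R)] v.
  by apply: measurable_funD; [apply: measurable_funD|];
    apply: measurable_funX; apply: measurable_funB.
have mC : measurable_fun [set: R * (R * R)]
    (fun p => [&& 0 < s p, 0 < v p & 3 * t ^+ 2 * v p < s p ^+ 2]).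
  apply: measurable_and; first exact: measurable_fun_ltr.
  apply: measurable_and; apply: measurable_fun_ltr => //.
    exact: measurable_funM.
  exact: measurable_funX.
by have := mC measurableT [set true] I; rewrite setTI.
Qed.

Section cone_section.
Variables (R : realType) (t a : R).
Hypothesis t_gt0 : 0 < t.
(** For [s = 1] the disc has radius [1 / (sqrt 3 * t)] in the plane of the triangle, and projection
    onto the first axis multiplies lengths by at most [sqrt (2 / 3)]; [a] is the product, up to
    sign. *)
Hypothesis a_sqr : 3 * t ^+ 2 * (3 * a ^+ 2) = 2.

(** Inner half of the sandwich. The midpoint is excluded because for [u = 1/3] it is the centre of
    the disc, where the variance is zero. *)
Lemma cone_chord_sub s u y : 0 < s -> u <= 1 ->
  `|2 * y - s * (1 - u)| < s * chord R a u -> y != s * (1 - u) / 2 ->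
  [/\ 0 <= y, 0 <= s * (1 - u) - y &
      ratio_cone R t (s * u, (y, s * (1 - u) - y))].
Proof.
move=> s0 u1 H yneq.
set w := s * (1 - u).
have /andP[H1 H2] : (`|2 * y - w| < s * (1 - u)) &&
    (`|2 * y - w| < s * (Num.sqrt 3 * Num.sqrt (a ^+ 2 - (u - 3^-1) ^+ 2))).
  by apply/andP; split; apply: (lt_le_trans H);
    rewrite ler_pM2l// ge_min lexx ?orbT.
move: (H1); rewrite ltr_norml -/w => /andP[? ?].
split; [lra|lra|].
have D0 : 0 < a ^+ 2 - (u - 3^-1) ^+ 2.
  rewrite ltNge; apply/negP => D; move: H2.
  by rewrite (ler0_sqrtr D) !mulr0 ltNge normr_ge0.
have H3 : (2 * y - w) ^+ 2 < s ^+ 2 * (3 * (a ^+ 2 - (u - 3^-1) ^+ 2)).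
  rewrite -[ltLHS]real_normK ?num_real//.
  have -> : s ^+ 2 * (3 * (a ^+ 2 - (u - 3^-1) ^+ 2)) =
      (s * (Num.sqrt 3 * Num.sqrt (a ^+ 2 - (u - 3^-1) ^+ 2))) ^+ 2.
    by rewrite [RHS]exprMn exprMn sqr_sqrtr// sqr_sqrtr//; exact: ltW.
  by rewrite ltr_pXn2r// ?nnegrE ?normr_ge0// !mulr_ge0 ?sqrtr_ge0 ?ltW.
have y2 : 0 < (2 * y - w) ^+ 2.
  rewrite exprn_even_gt0//= subr_eq0; apply: contra yneq => /eqP yw.
  by rewrite -/w -yw; apply/eqP; field.
have t2 : 0 < 3 * t ^+ 2 by rewrite mulr_gt0// exprn_gt0.
have sE : s * u + (y + (w - y)) = s by rewrite /w; ring.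
rewrite /ratio_cone/= sE s0/=.
(* The last two deviations have sum [- (s * u - s / 3)] and difference [2 * y - w]; the sum of their
   squares is half that of the squares of these two. *)
have -> : (s * u - s / 3) ^+ 2 + (y - s / 3) ^+ 2 + (w - y - s / 3) ^+ 2 =
   (3 * s ^+ 2 * (u - 3^-1) ^+ 2 + (2 * y - w) ^+ 2) / 2 by rewrite /w; field.
have u2 := sqr_ge0 (s * (u - 3^-1)); rewrite exprMn in u2.
apply/andP; split; first lra.
have := a_sqr.
rewrite -(ltr_pM2l t2) in H3; nra.
Qed.

Lemma cone_sub_chord s u y : 0 < s -> 0 <= y -> 0 <= s * (1 - u) - y ->
  ratio_cone R t (s * u, (y, s * (1 - u) - y)) ->
  `|2 * y - s * (1 - u)| <= s * chord R a u.
Proof.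
move=> s0 y0 wy; set w := s * (1 - u) in wy *.
have sE : s * u + (y + (w - y)) = s by rewrite /w; ring.
rewrite /ratio_cone/= sE => /and3P[_ _].
have -> : (s * u - s / 3) ^+ 2 + (y - s / 3) ^+ 2 + (w - y - s / 3) ^+ 2 =
   (3 * s ^+ 2 * (u - 3^-1) ^+ 2 + (2 * y - w) ^+ 2) / 2 by rewrite /w; field.
move=> H.
have t2 : 0 < 3 * t ^+ 2 by rewrite mulr_gt0// exprn_gt0.
have H3 : (2 * y - w) ^+ 2 <= s ^+ 2 * (3 * (a ^+ 2 - (u - 3^-1) ^+ 2)).
  by rewrite -(ler_pM2l t2); have := a_sqr; nra.
rewrite -ler_pdivrMl// /chord le_min !ler_pdivrMl//; apply/andP; split.
  by rewrite -/w ler_norml; apply/andP; split; lra.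
rewrite -sqrtrM// -{1}(ger0_norm (ltW s0)) -!sqrtr_sqr -sqrtrM ?sqr_ge0//.
exact: ler_wsqrtr.
Qed.

Let f := exponential_pdf (1 : R).

Let f_ge0 x : 0 <= f x.
Proof. exact: exponential_pdf_ge0. Qed.

Let fE x : 0 <= x -> f x = expR (- x).
Proof. by move=> x0; rewrite /f exponential_pdfE// mul1r mulN1r. Qed.

Let mf : measurable_fun [set: R] f.
Proof. exact: measurable_exponential_pdf. Qed.

Let g (p : R * (R * R)) : \bar R :=
  (f p.1 * f p.2.1 * f p.2.2 * \1_(ratio_cone R t) p)%:E.

Let g_ge0 p : (0 <= g p)%E.
Proof. by rewrite lee_fin !mulr_ge0. Qed.

Let mg : measurable_fun [set: R * (R * R)] g.
Proof.
apply/measurable_EFinP; apply: measurable_funM; last first.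
  by apply: measurable_indic; exact: measurable_ratio_cone.
apply: measurable_funM; [apply: measurable_funM|].
- exact: measurableT_comp.
- apply: (measurableT_comp mf).
  exact: (measurableT_comp measurable_fst measurable_snd).
- apply: (measurableT_comp mf).
  exact: (measurableT_comp measurable_snd measurable_snd).
Qed.

(** At a fixed sum [s] the joint density is the constant [expR (- s)] on the triangle, so only the
    length of the section [Y] matters; the two inclusions above determine it. *)
Lemma integral_cone_chord s u : 0 < s -> 0 <= u <= 1 ->
  (\int[lebesgue_measure]_y g (s * u, (y, s * (1 - u) - y))%R =
  (expR (- s) * (s * chord R a u))%:E)%E.
Proof.
move=> s0 /andP[u0 u1]; set w := s * (1 - u); set m := s * chord R a u.
have m0 : 0 <= m by rewrite mulr_ge0 ?(ltW s0)// chord_ge0.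
have w0 : 0 <= w by rewrite mulr_ge0 ?(ltW s0)//; lra.
pose Y := `[0, w]%classic `&`
  (fun y => (s * u, (y, w - y))) @^-1` ratio_cone R t.
have mY : measurable Y.
  have mpair : measurable_fun [set: R] (fun y => (s * u, (y, w - y))).
    by apply: measurable_fun_pair => //; apply: measurable_fun_pair => //;
      exact: measurable_funB.
  apply: measurableI; first exact: measurable_itv.
  rewrite -[X in measurable X]setTI.
  by apply: mpair => //; exact: measurable_ratio_cone.
have lY : lebesgue_measure Y = m%:E.
  apply/eqP; rewrite eq_le; apply/andP; split.
    have -> : m%:E =
        lebesgue_measure `[(w / 2 - m / 2), (w / 2 + m / 2)]%classic.
      rewrite lebesgue_measure_itv/= lte_fin; case: ifPn => mm.
        by rewrite -EFinB; congr (_%:E); field.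
      by congr (_%:E); lra.
    apply: le_measure; rewrite ?inE// => y [/=].
    rewrite !in_itv/= => /andP[y0 yw] Cy.
    have wy : 0 <= w - y by lra.
    have := cone_sub_chord _ _ _ s0 y0 wy Cy.
    by rewrite -/w -/m ler_norml => /andP[? ?]; apply/andP; split; lra.
  (* Adding the midpoint, a null set, makes the whole open interval a subset. *)
  rewrite -(@measureU0 _ _ _ lebesgue_measure Y [set (w / 2)])//; last first.
    exact: lebesgue_measure_set1.
  have -> : m%:E = lebesgue_measure `](w / 2 - m / 2), (w / 2 + m / 2)[%classic.
    rewrite lebesgue_measure_itv/= lte_fin; case: ifPn => mm.
      by rewrite -EFinB; congr (_%:E); field.
    by congr (_%:E); lra.
  apply: le_measure; rewrite ?inE//; first exact: measurableU.
  move=> y /=; rewrite in_itv/= => /andP[y1 y2].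
  have [->|yw] := eqVneq y (w / 2); [by right|left].
  have H : `|2 * y - w| < m by rewrite ltr_norml; apply/andP; split; lra.
  have [? ? ?] := cone_chord_sub _ _ _ s0 u1 H yw.
  by split => //=; rewrite in_itv/=; apply/andP; split => //; rewrite -subr_ge0.
transitivity (\int[lebesgue_measure]_y ((expR (- s))%:E * (\1_Y y)%:E))%E;
  last first.
  rewrite ge0_integralZl ?lee_fin ?expR_ge0//; last exact/measurable_EFinP.
  by rewrite integral_indic// setIT EFinM; congr (_ * _)%E; exact: lY.
apply: eq_integral => y _; rewrite /g/= -EFinM; congr (_%:E).
have [y0|y0] := leP 0 y; last first.
  rewrite {2}/f lt0_exponential_pdf// mulr0 !mul0r indicE memNset ?mulr0//.
  by case=> /=; rewrite in_itv/= => /andP[]; rewrite leNgt y0.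
have [wy|wy] := leP 0 (w - y); last first.
  rewrite {3}/f lt0_exponential_pdf// mulr0 !mul0r indicE memNset ?mulr0//.
  by case=> /=; rewrite in_itv/= => /andP[_ ?]; lra.
rewrite !fE ?mulr_ge0 ?(ltW s0)// -!expRD.
rewrite (_ : - (s * u) + - y + - (w - y) = - s); last by rewrite /w; ring.
congr (_ * _); rewrite !indicE; congr ((_ : bool)%:R).
apply/idP/idP; rewrite !in_setE; last by case.
by move=> Cy; split => //=; rewrite in_itv/=; apply/andP; split; lra.
Qed.

(** Two shears replace [z] by [w = y + z] and then [w] by [s = x + w]. The scaling [x = s * u]
    contributes one factor [s] and the section length another, so the integral in [s] separates as
    that of [s ^+ 2 * expR (- s)]. *)
Lemma integral_ratio_cone :
  (\int[lebesgue_measure]_x \int[lebesgue_measure]_y \int[lebesgue_measure]_z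
     g (x, (y, z)) =
   2%:E * \int[lebesgue_measure]_(u in `[0%R, 1%R]) (chord R a u)%:E)%E.
Proof.
pose h (q : R * R) := (\int[lebesgue_measure]_y g (q.1, (y, q.2 - y)%R))%E.
have h_ge0 q : (0 <= h q)%E by exact: integral_ge0.
have mh : measurable_fun [set: R * R] h.
  apply: (@measurable_fun_fubini_tonelli_F _ _ _ _ _ lebesgue_measure
    (fun p : R * R * R => g (p.1.1, (p.2, p.1.2 - p.2)))) => //.
  apply: (measurableT_comp mg); apply: measurable_fun_pair.
    exact: (measurableT_comp measurable_fst measurable_fst).
  apply: measurable_fun_pair => //; apply: measurable_funB => //.
  exact: (measurableT_comp measurable_snd measurable_fst).
transitivity (\int[lebesgue_measure]_x \int[lebesgue_measure]_w h (x, w))%E.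
  apply: eq_integral => x _.
  rewrite (ge0_integral_shear R (fun q => g (x, q)))//.
  by apply: (measurableT_comp mg); exact: measurable_fun_pair.
rewrite ge0_integral_shear//.
pose A := (\int[lebesgue_measure]_(u in `[0%R, 1%R]) (chord R a u)%:E)%E.
rewrite -/A.
have A_ge0 : (0 <= A)%E.
  apply: integral_ge0 => u /=; rewrite in_itv/= => /andP[_ u1].
  by rewrite lee_fin chord_ge0.
rewrite -integral_sqr_expRN -ge0_integralZr//; last 2 first.
- apply/measurable_EFinP; apply: measurable_funTS.
  apply: continuous_measurable_fun.
  by apply: derivable_continuous => x; exact: ex_derive.
- by move=> s _; rewrite lee_fin mulr_ge0 ?sqr_ge0 ?expR_ge0.
rewrite [RHS]integral_mkcond; apply: eq_integral => s _.
(* The cone requires [0 < s] while the right-hand domain contains 0; there the factor [s ^+ 2]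
   vanishes. *)
rewrite patchE; have [s0|s0] := ltP 0 s; last first.
  transitivity (0 : \bar R)%E.
    apply: integral0_eq => x _; apply: integral0_eq => y _.
    rewrite /g/= indicE memNset ?mulr0//= /ratio_cone/=.
    rewrite (_ : x + (y + (s - x - y)) = s); last by ring.
    by rewrite ltNge s0.
  case: ifPn => //; rewrite inE/= in_itv/= andbT => s0'.
  have -> : s = 0 by apply/eqP; rewrite eq_le s0 s0'.
  by rewrite expr0n/= mul0r mul0e.
rewrite ifT; last by rewrite inE/= in_itv/= ltW.
pose k u := h (s * u, s - s * u).
have mk : measurable_fun [set: R] k.
  apply: (measurableT_comp mh); apply: measurable_fun_pair.
    exact: measurable_funM.
  by apply: measurable_funB => //; exact: measurable_funM.
transitivity (\int[lebesgue_measure]_x k ((x - 0) / s)%R)%E.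
  apply: eq_integral => x _; rewrite /k subr0 mulrCA divff ?gt_eqF// mulr1//.
rewrite ge0_integral_affine//; last by move=> ?; exact: h_ge0.
have -> : ((s ^+ 2 * expR (- s))%:E = s%:E * (s * expR (- s))%:E)%E.
  by rewrite -EFinM mulrA -expr2.
rewrite -muleA; congr (_ * _)%E.
rewrite -ge0_integralZl//; last 3 first.
- by apply/measurable_EFinP/measurable_funTS; exact: measurable_chord.
- by move=> u /=; rewrite in_itv/= => /andP[_ ?]; rewrite lee_fin chord_ge0.
- by rewrite lee_fin mulr_ge0 ?expR_ge0// ltW.
rewrite [RHS]integral_mkcond; apply: eq_integral => u _; rewrite patchE.
have hE : s - s * u = s * (1 - u) by ring.
case: ifPn.
  rewrite inE/= in_itv/= => u01.
  rewrite /k /h/= hE integral_cone_chord// -EFinM.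
  by congr (_%:E); ring.
rewrite notin_setE/= in_itv/= => /negP; rewrite negb_and -!ltNge => u01.
apply: integral0_eq => y _; rewrite /g/=.
(* If [u < 0] the first coordinate is negative; if [1 < u] the other two have a negative sum. In
   both cases one density is zero. *)
case/orP: u01 => [u0|u1].
  by rewrite {1}/f lt0_exponential_pdf ?mul0r// pmulr_rlt0.
have [y0|y0] := ltP y 0.
  by rewrite {2}/f lt0_exponential_pdf// mulr0 !mul0r.
rewrite {3}/f lt0_exponential_pdf ?mulr0 ?mul0r//.
by rewrite hE; nra.
Qed.

End cone_section.

(** * Samples of size three *)

(** The factors 3 turn the mean and the variance into the sums used by [ratio_cone]. Positivity of
    the mean must be kept when squaring, and for [v = 0] the quotient is 0, which does not exceed
    [t]. *)
Lemma lt_div_sqrt (R : realType) (t m v : R) : 0 < t -> 0 <= v ->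
  (t < m / Num.sqrt v) =
  [&& 0 < 3 * m, 0 < 3 * v & 3 * t ^+ 2 * (3 * v) < (3 * m) ^+ 2].
Proof.
move=> t0; rewrite le_eqVlt => /predU1P[<-|v0].
  by rewrite sqrtr0 invr0 !mulr0 ltxx andbF; apply/negbTE; rewrite -leNgt ltW.
have sv0 : 0 < Num.sqrt v by rewrite sqrtr_gt0.
rewrite ltr_pdivlMr// !pmulr_rgt0// v0 andTb.
have [m0|m0] := ltP 0 m; last first.
  by apply/negbTE; rewrite -leNgt (le_trans m0)// ltW// mulr_gt0.
rewrite andTb -(ltr_pXn2r (n := 2))// ?nnegrE ?mulr_ge0 ?ltW//.
rewrite !exprMn sqr_sqrtr ?(ltW v0)//.
by apply/idP/idP; nra.
Qed.

Section random_sample3.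
Context {R : realType} {d : measure_display} {Omega : measurableType d}.
Context {P : probability Omega R}.
Variable X : 'I_3 -> {RV P >-> R}.
Let i0 : 'I_3 := ord0.
Let i1 : 'I_3 := lift ord0 ord0.
Let i2 : 'I_3 := lift ord0 (lift ord0 ord0).

Lemma mean_sd_ratio_gtE (t : R) : 0 < t ->
  mean_sd_ratio X @^-1` `]t, +oo[ =
  (fun w => (X i0 w, (X i1 w, X i2 w))) @^-1` ratio_cone R t.
Proof.
move=> t0; apply/seteqP.
suff H w : (t < mean_sd_ratio X w) =
    ratio_cone R t (X i0 w, (X i1 w, X i2 w)) :> Prop.
  by split=> w /=; rewrite in_itv/= andbT H.
have v0 : 0 <= sample_variance X w.
  by rewrite mulr_ge0 ?invr_ge0// sumr_ge0// => i _; exact: sqr_ge0.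
rewrite /mean_sd_ratio /sample_sd lt_div_sqrt// /ratio_cone/=.
have -> : 3 * sample_mean X w = X i0 w + (X i1 w + X i2 w).
  rewrite /sample_mean !big_ord_recl big_ord0 addr0 -/i0 -/i1 -/i2.
  by rewrite mulrA divff ?mul1r.
have mE : sample_mean X w = (X i0 w + (X i1 w + X i2 w)) / 3.
  by rewrite /sample_mean !big_ord_recl big_ord0 addr0 -/i0 -/i1 -/i2 mulrC.
have -> // : 3 * sample_variance X w =
    (X i0 w - (X i0 w + (X i1 w + X i2 w)) / 3) ^+ 2 +
    (X i1 w - (X i0 w + (X i1 w + X i2 w)) / 3) ^+ 2 +
    (X i2 w - (X i0 w + (X i1 w + X i2 w)) / 3) ^+ 2.
rewrite /sample_variance mE !big_ord_recl big_ord0 addr0 -/i0 -/i1 -/i2.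
by rewrite mulrA divff ?mul1r// addrA.
Qed.

Lemma mutually_independent3 : mutually_independent X ->
  forall A0 A1 A2 : set R, measurable A0 -> measurable A1 -> measurable A2 ->
    P (X i0 @^-1` A0 `&` (X i1 @^-1` A1 `&` X i2 @^-1` A2)) =
    (P (X i0 @^-1` A0) * (P (X i1 @^-1` A1) * P (X i2 @^-1` A2)))%E.
Proof.
move=> indX A0 A1 A2 mA0 mA1 mA2.
pose A (i : 'I_3) := nth set0 [:: A0; A1; A2] i.
have := indX [set: 'I_3]%SET A.
rewrite (_ : \bigcap_(i in _) _ =
  X i0 @^-1` A0 `&` (X i1 @^-1` A1 `&` X i2 @^-1` A2)); last first.
  apply/seteqP; split=> [w H|w [H0 [H1 H2]] i _].
    split; first by have := H i0; rewrite /= inE; apply.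
    by split; [have := H i1|have := H i2]; rewrite /= inE; apply.
  case: i => -[|[|[|//]]] lti; rewrite /A/=.
  - by rewrite (_ : Ordinal lti = i0)//; exact: val_inj.
  - by rewrite (_ : Ordinal lti = i1)//; exact: val_inj.
  - by rewrite (_ : Ordinal lti = i2)//; exact: val_inj.
move=> ->; last by move=> [[|[|[|//]]] lti] _.
under eq_bigl do rewrite inE.
by rewrite !big_ord_recl big_ord0 mule1.
Qed.

Lemma exponential_mean_sd_ratio_ccdf (t a : R) : 0 < t ->
  3 * t ^+ 2 * (3 * a ^+ 2) = 2 ->
  random_sample X (exponential_prob (1 : R)) ->
  (ccdf (mean_sd_ratio X : {RV P >-> R}) t =
  2%:E * \int[lebesgue_measure]_(u in `[0%R, 1%R]) (chord R a u)%:E)%E.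
Proof.
move=> t0 at2 [indX lawX].
rewrite -(integral_ratio_cone R t a t0 at2).
have mX i : measurable_fun [set: Omega] (X i : Omega -> measurableTypeR R).
  have mXi : measurable_fun [set: Omega] (X i) by exact: measurable_funPT.
  exact: mXi.
pose Y i : {RV P >-> measurableTypeR R} :=
  HB.pack (X i : Omega -> measurableTypeR R)
    (isMeasurableFun.Build _ _ _ _ _ (mX i)).
rewrite /ccdf /distribution /pushforward mean_sd_ratio_gtE//.
apply: (joint_density3 R d Omega P (Y i0) (Y i1) (Y i2) (exponential_pdf 1)).
- exact: measurable_exponential_pdf.
- by move=> x; exact: exponential_pdf_ge0.
- exact: mutually_independent3.
- by move=> A mA; exact: (lawX i0 A mA).
- by move=> A mA; exact: (lawX i1 A mA).
- by move=> A mA; exact: (lawX i2 A mA).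
- exact: measurable_ratio_cone.
Qed.

End random_sample3.

Theorem proposition1 (R : realType) (d : measure_display)
    (Omega : measurableType d) (P : probability Omega R)
    (X : 'I_3 -> {RV P >-> R})
    (sampleX : random_sample X (exponential_prob (1 : R))) (t : R) :
  (Num.sqrt 2 <= t ->
     cdf (mean_sd_ratio X : {RV P >-> R}) t =
       (1 - 2 * pi / (3 * Num.sqrt 3 * t ^+ 2))%:E) /\
  (Num.sqrt 2 / 2 <= t <= Num.sqrt 2 ->
     cdf (mean_sd_ratio X : {RV P >-> R}) t =
       (- (Num.sqrt (2 - t ^+ 2) / (Num.sqrt 3 * t))
        + pi / (3 * Num.sqrt 3 * t ^+ 2)
        - 2 * asin (t / Num.sqrt 2) / (Num.sqrt 3 * t ^+ 2)
        + 1)%:E).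
Proof.
set q := Num.sqrt 2; set h := Num.sqrt 3.
have q0 : 0 < q by rewrite sqrtr_gt0.
have h0 : 0 < h by rewrite sqrtr_gt0.
have q2 : q ^+ 2 = 2 by rewrite sqr_sqrtr.
have h2 : h ^+ 2 = 3 by rewrite sqr_sqrtr.
(* The areas carry [sqrt 3] in the numerator, the statement in the denominator; this identity lets
   [field] close the gap. *)
have hE : h = 3 / h by rewrite -h2; field; rewrite gt_eqF.
pose a := q / (3 * t).
have at2 : 0 < t -> 3 * t ^+ 2 * (3 * a ^+ 2) = 2.
  by move=> t0; rewrite -q2 /a; field; lra.
split=> [tq|/andP[tq2 tq]].
  have t0 : 0 < t by lra.
  rewrite cdf_1_ccdf (exponential_mean_sd_ratio_ccdf _ _ _ t0 (at2 t0) sampleX).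
  rewrite integral_chord_inscribed; last first.
    by rewrite divr_gt0 ?mulr_gt0//= ler_pdivrMr ?mulr_gt0//; lra.
  rewrite -EFinM -EFinB -/h; congr (_ - _)%:E.
  by rewrite /a exprMn q2 {1}hE; field; rewrite !gt_eqF.
have t0 : 0 < t by lra.
have tq1 : 2^-1 <= t / q <= 1.
  by rewrite ler_pdivlMr// ler_pdivrMr// mul1r tq andbT; lra.
have tqN1 : -1 <= t / q <= 1 by lra.
(* The angle [b] of the truncated case is [asin (t / q)], since [a = q / (3 * t)] must equal
   [1 / (3 * sin b)]; the bound [q / 2 <= t] gives [pi / 6 <= b]. *)
have sb : sin (asin (t / q)) = t / q by rewrite asinK// in_itv.
have ab : a = (3 * sin (asin (t / q)))^-1.
  by rewrite sb /a; field; rewrite !gt_eqF.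
have cb : cos (asin (t / q)) = Num.sqrt (2 - t ^+ 2) / q.
  rewrite cos_asin//.
  have -> : 1 - (t / q) ^+ 2 = (2 - t ^+ 2) * q^-1 ^+ 2.
    by rewrite -[in RHS]q2; field; rewrite gt_eqF.
  rewrite sqrtrM; first by rewrite sqrtr_sqr ger0_norm// invr_ge0 ltW.
  by rewrite subr_ge0 -q2 ler_pXn2r// nnegrE ltW.
have b2 : asin (t / q) <= pi / 2 by exact: asin_lepi2.
have b6 : pi / 6 <= asin (t / q).
  rewrite leNgt; apply/negP => b6; have bN := asin_geNpi2 tqN1.
  have pi0 := pi_gt0 R.
  have : sin (asin (t / q)) < sin (pi / 6).
    by rewrite ltr_sin// in_itv/=; lra.
  by rewrite sb sin_pi6; lra.
rewrite cdf_1_ccdf (exponential_mean_sd_ratio_ccdf _ _ _ t0 (at2 t0) sampleX).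
rewrite ab integral_chord_truncated ?b6//.
rewrite -EFinM -EFinB -/h sb cb; congr (_%:E).
by rewrite expr_div_n q2 {1}hE; field; rewrite !gt_eqF.
Qed.
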